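(* Let $k \in \mathbb{N}$, $m \in \mathbb{N}_0$, let $U_1, \ldots, U_k \subseteq \operatorname{Sym}(\Omega)$, let $(f_{L,1}, f_{R,1}), \ldots, (f_{L,m}, f_{R,m})$ be a sequence in which each pair is a refiner for some $U_j$ with $j \in \{1,\ldots,k\}$, let $\mathrm{Approx}$ be an isomorphism approximator and let $\mathrm{Split}$ be a splitter for $\mathrm{Approx}$. Then the procedure call $\mathrm{Search}(\mathrm{EmptyStack}(\Omega), \mathrm{EmptyStack}(\Omega))$ (the algorithm defined in the context, run with these inputs) terminates after finitely many steps and returns the set $U_1 \cap \cdots \cap U_k$.
   Context: **Basic objects.** $\Omega$ is a finite totally ordered set. $\operatorname{Sym}(\Omega)$ acts on $\Omega$ on the right, written $\alpha^g$, and products $gh$ mean first $g$, then $h$. $\mathfrak{L}$ is a fixed non-empty set of labels, containing every label that is required. A *labelled digraph* on $\Omega$ is a triple $\Gamma = (\Omega, A, \mathrm{Label})$ with $A \subseteq \Omega \times \Omega$ (loops allowed) and $\mathrm{Label} : \Omega \cup A \to \mathfrak{L}$. For $g \in \operatorname{Sym}(\Omega)$, $\Gamma^g = (\Omega, A^g, \mathrm{Label}^g)$, where $A^g = \{(\alpha^g,\beta^g) : (\alpha,\beta)\in A\}$, $\mathrm{Label}^g(\delta) = \mathrm{Label}(\delta^{g^{-1}})$ and $\mathrm{Label}^g(\alpha,\beta) = \mathrm{Label}(\alpha^{g^{-1}},\beta^{g^{-1}})$. A *labelled digraph stack* on $\Omega$ is a finite (possibly empty) list $S$ of labelled digraphs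 on $\Omega$; $|S|$ is its length and $S[i]$ its $i$-th entry. $\mathrm{DigraphStacks}(\Omega)$ is the collection of all of them, $\mathrm{EmptyStack}(\Omega)$ is the one of length $0$, and $S \mathop{\Vert} T$ is the concatenation. $\operatorname{Sym}(\Omega)$ acts entrywise: $S^g[i] = S[i]^g$. Put $\operatorname{Iso}(S,T) = \{g \in \operatorname{Sym}(\Omega) : S^g = T\}$ and $\operatorname{Aut}(S) = \operatorname{Iso}(S,S)$; $S,T$ are *isomorphic* if $\operatorname{Iso}(S,T) \neq \varnothing$. **Refiner.** A refiner for $U \subseteq \operatorname{Sym}(\Omega)$ is a pair $(f_L,f_R)$ of functions from $\mathrm{DigraphStacks}(\Omega)$ to itself such that $U \cap \operatorname{Iso}(S,T) \subseteq U \cap \operatorname{Iso}(f_L(S), f_R(T))$ for all isomorphic stacks $S,T$. **Isomorphism approximator.** A function $\mathrm{Approx}$ mapping each pair of labelled digraph stacks on $\Omega$ to either $\varnothing$ or a right coset of a subgroup of $\operatorname{Sym}(\Omega)$ such that for all stacks $S,T$ (abbreviating $\mathrm{Approx}(S) = \mathrm{Approx}(S,S)$): (i) $\operatorname{Iso}(S,T) \subseteq \mathrm{Approx}(S,T)$; (ii) if $|S| \ne |T|$ then $\mathrm{Approx}(S,T) = \varnothing$; (iii) if $\mathrm{Approx}(S,T) \neq \varnothing$ then $\mathrm{Approx}(S,T) = \mathrm{Approx}(S)\cdot h$ for some $h \in \operatorname{Sym}(\Omega)$. **Splitter.** A splitter for $\mathrm{Approx}$ is a function $\mathrm{Split}$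 mapping each pair of stacks to a finite list of stacks such that for all $S,T$ with $|\mathrm{Approx}(S,T)| \ge 2$, $\mathrm{Split}(S,T) = [S_1, T_1, T_2, \ldots, T_n]$ for some $n \in \mathbb{N}_0$ and stacks $S_1,T_1,\ldots,T_n$ with: (i) $\operatorname{Iso}(S,T) = \bigcup_{i=1}^n \operatorname{Iso}(S \mathop{\Vert} S_1, T \mathop{\Vert} T_i)$; (ii) $|\mathrm{Approx}(S \mathop{\Vert} S_1, T \mathop{\Vert} T_i)| < |\mathrm{Approx}(S,T)|$ for all $i$; (iii) for all stacks $U$ with $|\mathrm{Approx}(S,U)| \ge 2$, the first entry of $\mathrm{Split}(S,U)$ is $S_1$. **The algorithm.** It is assumed that evaluations of the given approximator, splitter and refiners can be computed. Procedure $\mathrm{Refine}(S,T)$: - While $\mathrm{Approx}(S,T) \neq \varnothing$: store $(S',T') \gets (S,T)$; then, for $i = 1,\ldots,m$ in turn and as long as $|S| = |T|$, replace $(S,T)$ by $(S \mathop{\Vert} f_{L,i}(S),\, T \mathop{\Vert} f_{R,i}(T))$; then, if it is not the case that $|\mathrm{Approx}(S,T)| < |\mathrm{Approx}(S',T')|$, return $(S',T')$. - When the while-loop condition fails, return $(S,T)$. Procedure $\mathrm{Search}(S,T)$: - Replace $(S,T)$ by $\mathrm{Refine}(S,T)$. - If $\mathrm{Approx}(S,T) = \varnothing$, return $\varnothing$. - If $\mathrm{Approx}(S,T) = \{h\}$ for some $h$: return $\{h\}$ if $S^h = T$ and $h \in U_1 \cap \cdots \cap U_k$, otherwise return $\varnothing$.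 - If $|\mathrm{Approx}(S,T)| \ge 2$: let $[S_1,T_1,\ldots,T_t] = \mathrm{Split}(S,T)$ and return $\bigcup_{i=1}^t \mathrm{Search}(S \mathop{\Vert} S_1, T \mathop{\Vert} T_i)$. *)

(* Defs.v *)
From mathcomp Require Import all_boot all_order all_fingroup.
From mathcomp Require Import boolp.

Set Implicit Arguments.
Unset Strict Implicit.
Unset Printing Implicit Defensive.

Section Stacks.

Variables (Omega : finType) (L : Type).

(* Products of permutations are read from left to right in this library,
   [(g * h) x = h (g x)], so [g x] plays the role of x^g for a right action. *)

Definition arc_act (g : {perm Omega}) (a : Omega * Omega) : Omega * Omega :=
  (g a.1, g a.2).

(* The domain of [label] is the disjoint union of the vertex set and the arc
   set.  Since the arc set is a boolean set and the labelling is a finite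
   function, Leibniz equality of labelled digraphs is equality of triples. *)
Record ldigraph := LDigraph {
  arcs : {set Omega * Omega};
  label : {ffun Omega + {a : Omega * Omega | a \in arcs} -> L}
}.

Lemma arc_act_inv (g : {perm Omega}) (A : {set Omega * Omega}) a :
  a \in [set arc_act g b | b in A] -> arc_act (g^-1)%g a \in A.
Proof. by case/imsetP=> -[x y] Ab ->; rewrite /arc_act /= !permK. Qed.

Definition ldigraph_act (G : ldigraph) (g : {perm Omega}) : ldigraph :=
  @LDigraph [set arc_act g a | a in arcs G]
    [ffun x => match x with
               | inl d => label G (inl ((g^-1)%g d))
               | inr a => label G (inr (exist (fun b => b \in arcs G)
                            (arc_act (g^-1)%g (val a)) (arc_act_inv (valP a))))
               end].

Definition stack := seq ldigraph.

Definition stack_act (S : stack) (g : {perm Omega}) : stack :=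
  [seq ldigraph_act G g | G <- S].

Definition Iso (S T : stack) : {set {perm Omega}} :=
  [set g | `[< stack_act S g = T >]].

Definition isomorphic (S T : stack) : bool := Iso S T != set0.

Definition is_refiner (U : {set {perm Omega}})
    (f : (stack -> stack) * (stack -> stack)) : Prop :=
  forall S T, isomorphic S T ->
    U :&: Iso S T \subset U :&: Iso (f.1 S) (f.2 T).

Record is_approximator (Approx : stack -> stack -> {set {perm Omega}}) : Prop :=
  IsApproximator {
    approx_coset : forall S T, Approx S T = set0 \/
      exists (H : {group {perm Omega}}) (h : {perm Omega}),
        Approx S T = (H :* h)%g;
    approx_iso : forall S T, Iso S T \subset Approx S T;
    approx_size : forall S T, size S <> size T -> Approx S T = set0;
    approx_self : forall S T, Approx S T <> set0 ->
      exists h : {perm Omega}, Approx S T = (Approx S S :* h)%g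
  }.

Definition is_splitter (Approx : stack -> stack -> {set {perm Omega}})
    (Split : stack -> stack -> seq stack) : Prop :=
  forall S T, 2 <= #|Approx S T| ->
    exists (S1 : stack) (Ts : seq stack),
      [/\ Split S T = S1 :: Ts,
          Iso S T = \bigcup_(T' <- Ts) Iso (S ++ S1) (T ++ T'),
          all (fun T' => #|Approx (S ++ S1) (T ++ T')| < #|Approx S T|) Ts
        & forall U, 2 <= #|Approx S U| -> ohead (Split S U) = Some S1].

Section Algorithm.

Variables (k : nat) (U : 'I_k -> {set {perm Omega}})
          (fs : seq ((stack -> stack) * (stack -> stack)))
          (Approx : stack -> stack -> {set {perm Omega}})
          (Split : stack -> stack -> seq stack).

Fixpoint refine_pass (rs : seq ((stack -> stack) * (stack -> stack)))
    (S T : stack) : stack * stack :=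
  if rs is f :: rs' then
    if size S == size T then refine_pass rs' (S ++ f.1 S) (T ++ f.2 T)
    else (S, T)
  else (S, T).

(* [refine] and [search] take a bound on the number of loop iterations and on
   the depth of recursive calls; [None] means that the bound was exceeded (or,
   in [search], that [Split] returned an empty list, so that there is nothing
   to destructure).  A call terminates with value v exactly when the result is
   [Some v] for all large enough bounds. *)
Fixpoint refine (n : nat) (S T : stack) : option (stack * stack) :=
  if n is n'.+1 then
    if Approx S T == set0 then Some (S, T)
    else let: (S', T') := refine_pass fs S T in
      if #|Approx S' T'| < #|Approx S T| then refine n' S' T'
      else Some (S, T)
  else None.

Definition union_results (rs : seq (option {set {perm Omega}})) :
    option {set {perm Omega}} :=
  foldr (fun r acc => if (r, acc) is (Some A, Some B) then Some (A :|: B)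
                      else None) (Some set0) rs.

Fixpoint search (n : nat) (S0 T0 : stack) : option {set {perm Omega}} :=
  if n is n'.+1 then
    if refine n S0 T0 is Some (Sr, Tr) then
      if Approx Sr Tr == set0 then Some set0
      (* [unset1 A] is [Some h] if A = [set h], and [None] if A is not a
         singleton. *)
      else if unset1 (Approx Sr Tr) is Some h then
        Some (if `[< stack_act Sr h = Tr >] && (h \in \bigcap_(j < k) U j)
              then [set h] else set0)
      else if Split Sr Tr is S1 :: Ts then
        union_results [seq search n' (Sr ++ S1) (Tr ++ T') | T' <- Ts]
      else None
    else None
  else None.

End Algorithm.

End Stacks.

(* Main.v *)
Require Import Defs.
From mathcomp Require Import all_boot all_order all_fingroup.
From mathcomp Require Import boolp.

(** Write [V] for the intersection of the sets [U j].  The invariant of the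
    algorithm is the set [V :&: Iso S T] of solutions attached to a pair of
    stacks, and the measure that makes it stop is [#|Approx S T|].

    A refiner for some [U j] is also a refiner for the smaller set [V]
    ([is_refinerS]).  Appending refined stacks therefore keeps every solution,
    and it creates none, because an isomorphism between concatenations whose
    first parts have equal lengths is an isomorphism between these first parts
    ([Iso_cat]).  So refining leaves [V :&: Iso S T] unchanged
    ([refine_correct]).  It stops because each further turn of its loop makes
    the measure strictly smaller.

    The search of a pair returns exactly [V :&: Iso S T] ([search_correct]), by
    induction on the measure.  As [Approx S T] contains [Iso S T], an empty
    approximation leaves no solution and a singleton approximation leaves one
    candidate, which the algorithm tests.  Otherwise the splitter writes
    [Iso S T] as a union of sets of isomorphisms of pairs of smaller measure.
    On two empty stacks [Iso S T] is the whole symmetric group, so the search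
    that starts there returns [V]. *)

Set Implicit Arguments.
Unset Strict Implicit.
Unset Printing Implicit Defensive.

Section Correctness.

Variables (Omega : finType) (L : Type).
Implicit Types (S T A B : stack Omega L) (V W : {set {perm Omega}}).
Implicit Type f : (stack Omega L -> stack Omega L) *
                  (stack Omega L -> stack Omega L).

Lemma in_Iso S T (g : {perm Omega}) :
  (g \in Iso S T) = `[< stack_act S g = T >].
Proof. by rewrite inE. Qed.

Lemma Iso_nil : Iso ([::] : stack Omega L) [::] = [set: {perm Omega}].
Proof. by apply/setP=> g; rewrite in_Iso inE; apply/asboolP. Qed.

(** The action is entrywise, so it preserves lengths; equal lengths of [S] and
    [T] are what makes an equality of concatenations split at the same place. *)
Lemma Iso_cat S T A B : size S = size T ->
  Iso (S ++ A) (T ++ B) = Iso S T :&: Iso A B.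
Proof.
move=> eqST; apply/setP=> g; rewrite in_setI !in_Iso.
have szS : size (stack_act S g) = size T by rewrite size_map.
apply/asboolP/andP=> [|[/asboolP eS /asboolP eA]]; last first.
  by rewrite /stack_act map_cat -/(stack_act S g) eS -/(stack_act A g) eA.
rewrite /stack_act map_cat -/(stack_act S g) -/(stack_act A g) => eSA.
split; apply/asboolP.
  by rewrite -(take_size_cat (stack_act A g) szS) eSA take_size_cat.
by rewrite -(drop_size_cat (stack_act A g) szS) eSA drop_size_cat.
Qed.

Lemma is_refinerS V W f : V \subset W -> is_refiner W f -> is_refiner V f.
Proof.
move=> sVW refW S T isoST; apply/subsetP=> g /setIP[Vg Ig].
have : g \in W :&: Iso S T by rewrite inE (subsetP sVW).
by move/(subsetP (refW S T isoST))=> /setIP[_ ?]; rewrite inE Vg.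
Qed.

(** Refiners promise nothing for non-isomorphic stacks, but then [Iso S T] is
    empty and appending can only shrink it. *)
Lemma refiner_step V f S T : is_refiner V f -> size S = size T ->
  V :&: Iso (S ++ f.1 S) (T ++ f.2 T) = V :&: Iso S T.
Proof.
move=> refV eqST; rewrite Iso_cat // setIA; apply/setIidPl.
have [/eqP-> | isoST] := boolP (Iso S T == set0); first by rewrite setI0 sub0set.
by apply: subset_trans (refV S T isoST) _; apply: subsetIr.
Qed.

Lemma refine_pass_correct V rs f0 S T :
    (forall i, i < size rs -> is_refiner V (nth f0 rs i)) ->
  V :&: Iso (refine_pass rs S T).1 (refine_pass rs S T).2 = V :&: Iso S T.
Proof.
elim: rs S T => [|f rs IH] S T refV //=.
case: eqP => // eqST; rewrite IH => [|i ltis]; last exact: (refV i.+1).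
by apply: refiner_step => //; apply: (refV 0).
Qed.

Lemma union_results_map (X : Type) (p : pred X)
    (r : X -> option {set {perm Omega}}) (F : X -> {set {perm Omega}}) xs :
    (forall x, p x -> r x = Some (F x)) -> all p xs ->
  union_results [seq r x | x <- xs] = Some (\bigcup_(x <- xs) F x).
Proof.
move=> rF; elim: xs => [|x xs IH] /=; first by rewrite big_nil.
by case/andP=> px /IH; rewrite /union_results /= rF // => ->; rewrite big_cons.
Qed.

Variables (k : nat) (U : 'I_k -> {set {perm Omega}}).
Variable fs : seq ((stack Omega L -> stack Omega L) *
                   (stack Omega L -> stack Omega L)).
Variables (Approx : stack Omega L -> stack Omega L -> {set {perm Omega}})
          (Split : stack Omega L -> stack Omega L -> seq (stack Omega L)).

Let V := \bigcap_(j < k) U j.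

Hypothesis refV :
  forall f0 i, i < size fs -> is_refiner V (nth f0 fs i).
Hypothesis approx_iso : forall S T, Iso S T \subset Approx S T.
Hypothesis splitP : is_splitter Approx Split.

Lemma refine_correct n S T : #|Approx S T| < n ->
  exists Sr Tr, [/\ refine fs Approx n S T = Some (Sr, Tr),
                    V :&: Iso Sr Tr = V :&: Iso S T
                  & #|Approx Sr Tr| <= #|Approx S T|].
Proof.
elim: n S T => [|n IH] S T //= leAn.
case: ifP => _; first by exists S, T.
have := refine_pass_correct S T (refV (id, id)).
case: (refine_pass fs S T) => S' T' /= eqV.
case: ifP => [ltA | _]; last by exists S, T.
have [Sr [Tr [-> eqVr leA]]] := IH S' T' (leq_trans ltA leAn).
by exists Sr, Tr; split; rewrite ?eqVr // (leq_trans leA) // ltnW.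
Qed.

Lemma singleton_solutions S T (h : {perm Omega}) : Approx S T = [set h] ->
  (if `[< stack_act S h = T >] && (h \in V) then [set h] else set0)
    = V :&: Iso S T.
Proof.
move=> defA; have sIh := approx_iso S T; rewrite defA in sIh.
apply/setP=> g; rewrite -in_Iso andbC -in_setI.
have [-> | neq_gh] := eqVneq g h; first by case: ifP => // _; rewrite ?set11 ?inE.
have -> : g \in V :&: Iso S T = false.
  apply/negP=> /setIP[_ /(subsetP sIh)]; rewrite in_set1; exact/negP.
by case: ifP => _; rewrite !inE // (negPf neq_gh).
Qed.

(** One bound [n] serves for both recursions: a pair reached by splitting has
    a strictly smaller measure than the refined pair, hence than the given
    pair, so [n.-1] still exceeds it. *)
Lemma search_correct n S T : #|Approx S T| < n ->
  search U fs Approx Split n S T = Some (V :&: Iso S T).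
Proof.
elim: n S T => [|n IH] S T // ltAn.
have [Sr [Tr [defr eqV leA]]] := refine_correct ltAn.
(* One step of [search] is unfolded by hand: simplification would also unfold
   [refine] at [n.+1]. *)
rewrite [LHS](_ : _ = if refine fs Approx n.+1 S T is Some (Sr, Tr) then
  if Approx Sr Tr == set0 then Some set0
  else if unset1 (Approx Sr Tr) is Some h then
    Some (if `[< stack_act Sr h = Tr >] && (h \in V) then [set h] else set0)
  else if Split Sr Tr is S1 :: Ts then
    union_results
      [seq search U fs Approx Split n (Sr ++ S1) (Tr ++ T') | T' <- Ts]
  else None else None) // defr -eqV.
have [A0 | An0] := eqVneq (Approx Sr Tr) set0.
  have := approx_iso Sr Tr; rewrite A0 subset0 => /eqP->.
  by rewrite setI0.
have [/cards1P[h defA] | A1] := boolP (#|Approx Sr Tr| == 1).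
  by rewrite -(singleton_solutions defA) defA set1K.
have A2 : 1 < #|Approx Sr Tr| by rewrite ltn_neqAle eq_sym A1 card_gt0.
rewrite unset1N1 //.
have [S1 [Ts [-> defI ltTs _]]] := splitP A2.
rewrite defI big_distrr /=.
apply: union_results_map ltTs => T' ltT'; apply: IH.
by apply: leq_trans ltT' _; apply: leq_trans leA _.
Qed.

End Correctness.

Theorem theorem7p2 (disp : Order.disp_t) (Omega : finOrderType disp)
  (L : Type) (L_nonempty : inhabited L)
  (k m : nat) (k_gt0 : 0 < k)
  (U : 'I_k -> {set {perm Omega}})
  (f : m.-tuple ((stack Omega L -> stack Omega L) *
                 (stack Omega L -> stack Omega L)))
  (f_refiner : forall i : 'I_m, exists j : 'I_k, is_refiner (U j) (tnth f i))
  (Approx : stack Omega L -> stack Omega L -> {set {perm Omega}})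
  (Approx_approximator : is_approximator Approx)
  (Split : stack Omega L -> stack Omega L -> seq (stack Omega L))
  (Split_splitter : is_splitter Approx Split) :
  exists N : nat, forall n : nat, N <= n ->
    search U f Approx Split n [::] [::]
      = Some (\bigcap_(j < k) U j).
Proof.
exists #|Approx [::] [::]|.+1 => n ltAn.
rewrite search_correct //; first by rewrite Iso_nil setIT.
- move=> f0 i; rewrite size_tuple => ltim.
  have [j refUj] := f_refiner (Ordinal ltim).
  rewrite (tnth_nth f0) /= in refUj.
  by apply: is_refinerS refUj; apply: bigcap_inf.
- exact: approx_iso Approx_approximator.
Qed.
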